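(* In the extra-special case, every antichain $\Gamma$ of $\Delta(1)$ satisfies $\#\Gamma\le 3$; equivalently, $\deg\mathcal N_{\Delta(1)}(t)\le 3$.
   Context: Let $\mathfrak g$ be a complex simple Lie algebra with root system $\Delta$ in a real Euclidean space with $W$-invariant inner product $(\,,\,)$, simple roots $\Pi$, highest root $\theta$, $\theta^\vee=2\theta/(\theta,\theta)$. Extra-special case: $\Delta(j)=\{\gamma\in\Delta:(\gamma,\theta^\vee)=j\}$; $\Pi(0)=\Pi\cap\Delta(0)$; $\Delta(1)$ is partially ordered by $\mu\preccurlyeq\gamma$ iff $\gamma-\mu$ is a nonnegative integer combination of $\Pi(0)$. $\mathcal N_{\Delta(1)}(t)=\sum_{\Gamma}t^{\#\Gamma}$, summed over all antichains $\Gamma$ of $\Delta(1)$. *)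

(* Defs.v *)
From HB Require Import structures.
From mathcomp Require Import all_boot all_order all_algebra.
From mathcomp Require Import finmap.
From mathcomp Require Import complex.
From mathcomp Require Import boolp reals.

Set Implicit Arguments.
Unset Strict Implicit.
Unset Printing Implicit Defensive.

Import Order.TTheory GRing.Theory Num.Theory.

Local Open Scope ring_scope.

Section LieAlgebra.
Variables (K : fieldType) (g : vectType K) (br : {bilinear g -> g -> g}).
Implicit Types (I h : {vspace g}) (x y z : g).

Definition lie_algebra : Prop :=
  (forall x, br x x = 0) /\
  (forall x y z, br x (br y z) + br y (br z x) + br z (br x y) = 0).

Definition lie_ideal I : Prop := forall x y, y \in I -> br x y \in I.

Definition simple_lie_algebra : Prop :=
  [/\ lie_algebra,
      exists x, exists y, br x y != 0
    & forall I, lie_ideal I -> I = 0%VS \/ I = fullv].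

Definition lie_prodv I h : {vspace g} :=
  <<[seq br x y | x <- vbasis I, y <- vbasis h]>>%VS.

Definition lie_subalgebra h : Prop :=
  forall x y, x \in h -> y \in h -> br x y \in h.

Definition lie_nilpotent h : Prop :=
  exists n : nat, iter n (lie_prodv h) h = 0%VS.

Definition self_normalizing h : Prop :=
  forall x, (forall y, y \in h -> br x y \in h) -> x \in h.

Definition cartan_subalgebra h : Prop :=
  [/\ lie_subalgebra h, lie_nilpotent h & self_normalizing h].

Definition weight h := 'Hom(subvs_of h, K^o).

Definition lie_root h (lambda : weight h) : Prop :=
  lambda != 0 /\
  exists2 x, x != 0 & forall y : subvs_of h, br (vsval y) x = lambda y *: x.

End LieAlgebra.

Section RootSystem.
Variables (R : realType) (V : vectType R) (dot : {dot V for idfun}).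
Implicit Types (Delta Pi Gamma S : {fset V}) (a b v theta : V).

Definition coroot a : V := (2 / dot a a) *: a.

Definition reflection a v : V := v - dot v (coroot a) *: a.

(* The Weyl group W is generated by the orthogonal reflections in the roots,
   so the inner product [dot] is W-invariant by construction. *)
Definition root_system Delta : Prop :=
  [/\ <<Delta>>%VS = fullv, 0 \notin Delta,
      (forall a (c : R), a \in Delta -> c *: a \in Delta -> c = 1 \/ c = -1),
      (forall a b, a \in Delta -> b \in Delta -> reflection a b \in Delta)
    & (forall a b, a \in Delta -> b \in Delta ->
         exists m : int, dot b (coroot a) = m%:~R)].

Definition nat_comb S v : Prop :=
  exists c : V -> nat, v = \sum_(a <- S) a *+ c a.

Definition simple_roots Delta Pi : Prop :=
  [/\ (Pi `<=` Delta)%fset, free Pi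
    & forall b, b \in Delta -> nat_comb Pi b \/ nat_comb Pi (- b)].

Definition highest_root Delta Pi theta : Prop :=
  theta \in Delta /\ forall b, b \in Delta -> nat_comb Pi (theta - b).

Definition level theta S (j : int) : {fset V} :=
  [fset b in S | dot b (coroot theta) == j%:~R]%fset.

Definition preceq S (mu gamma : V) : Prop := nat_comb S (gamma - mu).

(* [Pi0] induces the order, [S] is the underlying set of the poset. *)
Definition antichain (Pi0 S Gamma : {fset V}) : Prop :=
  (Gamma `<=` S)%fset /\
  (forall mu gamma, mu \in Gamma -> gamma \in Gamma ->
     preceq Pi0 mu gamma -> mu = gamma).

(* The Narayana polynomial, i.e. the generating function of the antichains. *)
Definition narayana_poly (Pi0 S : {fset V}) : {poly int} :=
  \sum_(Gamma <- fpowerset S | `[< antichain Pi0 S Gamma >]) 'X^(#|` Gamma|).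

End RootSystem.

(* [Delta] is the root system of (g, h): the Euclidean space V is identified,
   through the R-linear injection [rho], with the real span of the roots in
   the complex dual of h, and [Delta] with the set of roots. *)
Definition root_system_of (R : realType) (g : vectType R[i])
    (br : {bilinear g -> g -> g}) (h : {vspace g})
    (V : vectType R) (dot : {dot V for idfun}) (Delta : {fset V}) : Prop :=
  root_system dot Delta /\
  exists rho : V -> weight h,
    [/\ (forall u v, rho (u + v) = rho u + rho v),
        (forall (c : R) v, rho (c *: v) = (c%:C)%C *: rho v),
        injective rho
      & forall lambda : weight h,
          lie_root br lambda <-> exists2 a, a \in Delta & rho a = lambda].

(* Main.v *)
Require Import Defs.
From mathcomp Require Import all_boot all_order all_algebra.
From mathcomp Require Import finmap complex boolp reals.
From mathcomp Require Import ring lra.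
Import Order.TTheory GRing.Theory Num.Theory.
Local Open Scope ring_scope.

(** Put [q = (theta, theta)].  Incomparable elements of [Delta1] have a
    nonpositive inner product, since otherwise their difference is a root of
    level 0.  Elements [x] of [Delta1] satisfy [(x, theta) = q / 2] and
    [(x, x) <= q], so for an antichain [x1, ..., x4]
    [0 <= |x1 + x2 + x3 + x4 - 2 theta|^2
       = \sum_i |x_i|^2 + 2 \sum_(i < j) (x_i, x_j) - 4 q <= 0].
    Hence the [x_i] are orthogonal, have length [|theta|], and sum up to
    [2 theta].  Then the three vectors [theta - x1 - x_j] are roots of level 0,
    so two of them have the same sign; but the sum of these two is [x_k - x1],
    where [k] is the remaining index, so [x_k] and [x1] are comparable. *)

Section RootSystem.
Context {R : realType} {V : vectType R} (dot : {dot V for idfun}).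
Implicit Types (u v w : V) (S : {fset V}).

(** * Bilinearity of the inner product and nonnegative combinations *)

Lemma dotC u v : dot u v = dot v u.
Proof. by rewrite (hermC dot) /= expr0 mul1r. Qed.

Lemma dotDl w u v : dot (u + v) w = dot u w + dot v w.
Proof. exact: linearDl. Qed.

Lemma dotNl w u : dot (- u) w = - dot u w.
Proof. exact: linearNl. Qed.

Lemma dotZl w (c : R) u : dot (c *: u) w = c * dot u w.
Proof. exact: linearZl_LR. Qed.

Lemma dotDr w u v : dot w (u + v) = dot w u + dot w v.
Proof. by rewrite !(dotC w) dotDl. Qed.

Lemma dotNr w u : dot w (- u) = - dot w u.
Proof. by rewrite !(dotC w) dotNl. Qed.

Lemma dotZr w (c : R) u : dot w (c *: u) = c * dot w u.
Proof. by rewrite !(dotC w) dotZl. Qed.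

Definition dotE := (dotDl, dotDr, dotNl, dotNr, dotZl, dotZr).

Lemma dot_gt0 u : u != 0 -> 0 < dot u u.
Proof. exact: neq0_dnorm_gt0. Qed.

Lemma dot_le0_eq0 u : dot u u <= 0 -> u = 0.
Proof.
by move=> u_le0; apply/eqP; apply: contraTT u_le0 => /dot_gt0; rewrite ltNge.
Qed.

(** Clears the denominator [dot v v], so that facts about coroots become linear in inner products
    and are within reach of [lra]. *)
Lemma dot_coroot u v (c : R) :
  v != 0 -> dot u (coroot dot v) = c <-> dot u v * 2 = c * dot v v.
Proof.
move=> /dot_gt0/lt0r_neq0 v0; rewrite /coroot dotZr.
by split=> [<-|uv]; [|apply: (mulIf v0); rewrite -uv]; field.
Qed.

Lemma pair_sum (t a b c d : V) :
  a + b + c + d = 2 *: t -> (t - a - b) + (t - a - c) = d - a.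
Proof.
move=> abcd; rewrite addrACA (addrACA t) -mulr2n -scaler_nat -abcd !addrA.
by rewrite [LHS](ACl ((1 * 5) * (2 * 7) * (3 * 8) * (4 * 6))) /= !subrr !add0r.
Qed.

Lemma nat_combD S u v : nat_comb S u -> nat_comb S v -> nat_comb S (u + v).
Proof.
move=> [c ->] [d ->]; exists (fun a => c a + d a)%N.
by rewrite -big_split /=; apply: eq_bigr => a _; rewrite mulrnDr.
Qed.

(** Coordinates in a free family are unique: the one of [c *: u] at [u] is [c], and it is also a
    natural number. *)
Lemma nat_comb_scale S u (c : R) :
  free S -> u \in S -> nat_comb S (c *: u) -> 0 <= c.
Proof.
move=> freeS uS [n cu].
have cuS : c *: u \in <<S>>%VS by rewrite memvZ // memv_span.
have [k _ k_uniq] := free_span freeS cuS.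
have <- : (n u)%:R = c; last exact: ler0n.
rewrite (k_uniq (fun v => (n v)%:R)) //; last first.
  by rewrite cu; apply: eq_bigr => v _; rewrite scaler_nat.
rewrite -(k_uniq (fun v => if v == u then c else 0)) ?eqxx //.
rewrite (bigD1_seq u) ?fset_uniq //= eqxx big1 ?addr0 // => v /negPf ->.
by rewrite scale0r.
Qed.

Section Highest.
Variables (Delta Pi : {fset V}) (theta : V).
Hypothesis Delta_root : root_system dot Delta.
Hypothesis Pi_simple : simple_roots Delta Pi.
Hypothesis theta_highest : highest_root Delta Pi theta.

Let Delta1 := level dot theta Delta 1.
Let Pi0 := level dot theta Pi 0.
Let q := dot theta theta.

(** * Differences of roots *)

Lemma root_neq0 u : u \in Delta -> u != 0.
Proof. by case: Delta_root => _ D0 _ _ _; apply: contraTneq => ->. Qed.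

(** The last hypothesis says that the Cartan integer is 1, so [u - v] is the reflection of [u] in
    [v]. *)
Lemma root_sub u v :
  u \in Delta -> v \in Delta -> dot u v * 2 = dot v v -> u - v \in Delta.
Proof.
case: (Delta_root) => _ _ _ refl _ uD vD uv; have := refl v u vD uD.
by rewrite /reflection (proj2 (dot_coroot u v 1 (root_neq0 _ vD))) ?mul1r ?scale1r.
Qed.

Lemma coroot_int u v : u \in Delta -> v \in Delta ->
  exists m : int, dot u v * 2 = m%:~R * dot v v.
Proof.
case: (Delta_root) => _ _ _ _ crys uD vD; have [m] := crys v u vD uD.
by move=> /(proj1 (dot_coroot u v _ (root_neq0 _ vD))) ?; exists m.
Qed.

(** Both Cartan integers are positive. If one of them is 1, [root_sub] applies. Otherwise both are
    at least 2, so [dot u v] bounds [dot u u] and [dot v v], whence [u - v] has norm at most 0 and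
    [u = v]. *)
Lemma root_sub_pos u v : u \in Delta -> v \in Delta -> u != v ->
  0 < dot u v -> u - v \in Delta \/ v - u \in Delta.
Proof.
move=> uD vD uv uv_gt0.
have [m mE] := coroot_int _ _ uD vD; have [n nE] := coroot_int _ _ vD uD.
have v_gt0 := dot_gt0 _ (root_neq0 _ vD).
have u_gt0 := dot_gt0 _ (root_neq0 _ uD).
have nE' : dot u v * 2 = n%:~R * dot u u by rewrite dotC.
have m_gt0 : 0 < m.
  by rewrite -(ltr0z R) -(pmulr_lgt0 _ v_gt0) -mE mulr_gt0.
have n_gt0 : 0 < n.
  by rewrite -(ltr0z R) -(pmulr_lgt0 _ u_gt0) -nE' mulr_gt0.
have [m1|m1] := eqVneq m 1.
  by left; apply: root_sub => //; rewrite mE m1 mul1r.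
have [n1|n1] := eqVneq n 1.
  by right; apply: root_sub => //; rewrite nE n1 mul1r.
have m2 : 2 <= m%:~R :> R by rewrite (ler_int R 2) -[2]/(1 + 1) lezD1 lt_neqAle eq_sym m1.
have n2 : 2 <= n%:~R :> R by rewrite (ler_int R 2) -[2]/(1 + 1) lezD1 lt_neqAle eq_sym n1.
case/negP: uv; rewrite -subr_eq0; apply/eqP/dot_le0_eq0.
have := ler_wpM2r (ltW v_gt0) m2; have := ler_wpM2r (ltW u_gt0) n2.
by rewrite -mE -nE' !dotE [dot v u]dotC; lra.
Qed.

(** * Levels with respect to the highest root *)

Lemma theta_root : theta \in Delta.
Proof. by case: theta_highest. Qed.

Lemma q_gt0 : 0 < q.
Proof. exact/dot_gt0/root_neq0/theta_root. Qed.

(** Dominance of [theta]: its reflection in [u] is a root [theta - c *: u], and maximality of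
    [theta] makes [c *: u] a nonnegative combination of [Pi]. *)
Lemma dot_simple_ge0 u : u \in Pi -> 0 <= dot u theta.
Proof.
move=> uPi; case: Pi_simple => /fsubsetP/(_ u uPi) uD freePi _.
case: (Delta_root) => _ _ _ refl _.
have := proj2 theta_highest _ (refl u theta uD theta_root).
rewrite /reflection opprB addrC subrK => /(nat_comb_scale _ _ _ freePi uPi).
have u0 := root_neq0 _ uD; have u_gt0 := dot_gt0 _ u0.
set c := dot theta _ => c_ge0.
have := proj1 (dot_coroot theta u c u0) erefl.
by rewrite dotC; have := mulr_ge0 c_ge0 (ltW u_gt0); lra.
Qed.

Lemma mem_Pi0 u : (u \in Pi0) = (u \in Pi) && (dot u theta == 0).
Proof.
rewrite !inE /=; congr andb; apply/eqP/eqP => [|u0].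
  by move=> /(proj1 (dot_coroot _ _ _ (root_neq0 _ theta_root))); lra.
by apply/(dot_coroot _ _ _ (root_neq0 _ theta_root)); rewrite u0 !mul0r.
Qed.

(** By dominance all terms of [dot u theta] are nonnegative. Their sum is zero, so each vanishes,
    and simple roots outside [Pi0] have coefficient zero. *)
Lemma nat_comb_level0 u :
  nat_comb Pi u -> dot u theta = 0 -> nat_comb Pi0 u.
Proof.
move=> [c ->] u0; exists c; rewrite /Pi0 /level -big_fset_condE /=.
rewrite [LHS](bigID (fun a => dot a (coroot dot theta) == 0%:~R)) /=.
rewrite [X in _ + X]big1_seq ?addr0 // => a /andP[a0 aPi].
have c_ge0 b : b \in Pi -> 0 <= dot (b *+ c b) theta.
  by move=> bPi; rewrite -scaler_nat dotZl mulr_ge0 ?dot_simple_ge0.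
move/eqP: u0; rewrite linear_sumlz big_seq psumr_eq0 // => /allP/(_ a aPi).
rewrite aPi /= -scaler_nat dotZl mulf_eq0 => /orP[/eqP ->|at0].
  by rewrite scale0r.
by have := mem_Pi0 a; rewrite !inE /= aPi at0 (negPf a0).
Qed.

Lemma root_level0 u : u \in Delta -> dot u theta = 0 ->
  nat_comb Pi0 u \/ nat_comb Pi0 (- u).
Proof.
move=> uD u0; case: Pi_simple => _ _ /(_ u uD) [uP|uN]; [left|right].
  exact: nat_comb_level0.
by apply: nat_comb_level0; rewrite ?dotNl ?u0 ?oppr0.
Qed.

Lemma level1_root u : u \in Delta1 -> u \in Delta.
Proof. by rewrite !inE => /andP[]. Qed.

Lemma level1_dot u : u \in Delta1 -> dot u theta * 2 = q.
Proof.
rewrite !inE => /andP[_ /eqP].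
by move=> /(proj1 (dot_coroot _ _ _ (root_neq0 _ theta_root))); rewrite mul1r.
Qed.

(** The Cartan integer [n] of [theta] against [u] satisfies [q = n * dot u u]; it is positive, hence
    at least 1. *)
Lemma level1_norm u : u \in Delta1 -> dot u u <= q.
Proof.
move=> u1; have [n] := coroot_int _ _ theta_root (level1_root _ u1).
have u_gt0 := dot_gt0 _ (root_neq0 _ (level1_root _ u1)).
rewrite dotC level1_dot // => nE.
have n_gt0 : 0 < n by rewrite -(ltr0z R) -(pmulr_lgt0 _ u_gt0) -nE q_gt0.
have n1 : 1 <= n%:~R :> R by rewrite (ler_int R 1) -gtz0_ge1.
by rewrite nE ler_peMl // ltW.
Qed.

(** * Antichains of level 1 *)

Section Antichain.
Variable Gamma : {fset V}.
Hypothesis Gamma_antichain : antichain Pi0 Delta1 Gamma.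

Lemma antichain_level1 u : u \in Gamma -> u \in Delta1.
Proof. by case: Gamma_antichain => /fsubsetP sub _ /sub. Qed.

Lemma antichain_incomp u v : u \in Gamma -> v \in Gamma -> u != v ->
  ~ (nat_comb Pi0 (u - v) \/ nat_comb Pi0 (v - u)).
Proof.
case: Gamma_antichain => _ incomp uG vG /eqP uv [vu|uv']; apply: uv.
  by apply/esym/incomp.
exact: incomp.
Qed.

Lemma antichain_dot_le0 u v : u \in Gamma -> v \in Gamma -> u != v ->
  dot u v <= 0.
Proof.
move=> uG vG uv; rewrite leNgt; apply/negP => uv_gt0.
have [u1 v1] := (antichain_level1 _ uG, antichain_level1 _ vG).
have uv0 : dot (u - v) theta = 0.
  by rewrite !dotE; have := level1_dot _ u1; have := level1_dot _ v1; lra.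
apply: (antichain_incomp _ _ uG vG uv).
have [] := root_sub_pos _ _ (level1_root _ u1) (level1_root _ v1) uv uv_gt0.
  by move/root_level0 => /(_ uv0); rewrite opprB.
have vu0 : dot (v - u) theta = 0 by rewrite -opprB dotNl uv0 oppr0.
by move/root_level0 => /(_ vu0); rewrite opprB; case; [right|left].
Qed.

Lemma antichain_four x1 x2 x3 x4 :
  uniq [:: x1; x2; x3; x4] -> {subset [:: x1; x2; x3; x4] <= Gamma} -> False.
Proof.
rewrite /= !inE !negb_or -!andbA.
case/and5P=> n12 n13 n14 n23 /and3P[n24 n34 _] sub.
have [g1 g2 g3 g4] : [/\ x1 \in Gamma, x2 \in Gamma, x3 \in Gamma & x4 \in Gamma].
  by split; apply: sub; rewrite !inE eqxx ?orbT.
have := (antichain_dot_le0 _ _ g1 g2 n12, antichain_dot_le0 _ _ g1 g3 n13,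
  antichain_dot_le0 _ _ g1 g4 n14, antichain_dot_le0 _ _ g2 g3 n23,
  antichain_dot_le0 _ _ g2 g4 n24, antichain_dot_le0 _ _ g3 g4 n34).
move=> [[[[[d12 d13] d14] d23] d24] d34].
have [l1 l2] := (antichain_level1 _ g1, antichain_level1 _ g2).
have [l3 l4] := (antichain_level1 _ g3, antichain_level1 _ g4).
have [t1 t2] := (level1_dot _ l1, level1_dot _ l2).
have [t3 t4] := (level1_dot _ l3, level1_dot _ l4).
have [q1 q2] := (level1_norm _ l1, level1_norm _ l2).
have [q3 q4] := (level1_norm _ l3, level1_norm _ l4).
pose s := x1 + x2 + x3 + x4 - 2 *: theta.
(* The cross terms with [2 *: theta] contribute [- 8 * q], and its norm contributes [4 * q]. *)
have sE : dot s s = dot x1 x1 + dot x2 x2 + dot x3 x3 + dot x4 x4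
    + 2 * (dot x1 x2 + dot x1 x3 + dot x1 x4 + dot x2 x3 + dot x2 x4 + dot x3 x4)
    - 4 * q.
  rewrite /s !dotE (dotC x2 x1) (dotC x3 x1) (dotC x4 x1) (dotC x3 x2).
  rewrite (dotC x4 x2) (dotC x4 x3) !(dotC theta) -/q.
  by lra.
have s0 : s = 0 by apply: dot_le0_eq0; rewrite sE; lra.
have ss0 : dot s s = 0 by rewrite s0 -(scale0r 0) dotZl mul0r.
have sum_x : x1 + x2 + x3 + x4 = 2 *: theta by apply/eqP; rewrite -subr_eq0 -/s s0.
(* Two successive reflections: the equality case also forces [dot x1 x1 = q], so [theta - x1] is a
   root, and its Cartan integer against [x] is 1 because [x1] is orthogonal to [x]. *)
have diff_level0 x : x \in Delta1 -> dot x1 x = 0 -> dot x x = q ->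
    nat_comb Pi0 (theta - x1 - x) \/ nat_comb Pi0 (- (theta - x1 - x)).
  move=> lx d1x qx; have tx := level1_dot _ lx.
  apply: root_level0; last by rewrite !dotE -/q; lra.
  apply: root_sub (level1_root _ lx) _; last by rewrite !dotE (dotC theta); lra.
  apply: root_sub theta_root (level1_root _ l1) _.
  by rewrite dotC t1; lra.
(* Now [dot s s = 0] is a vanishing sum of the nonnegative slacks of all the inequalities above, up
   to sign, so each of them is an equality. *)
have [q2' q3' q4'] : [/\ dot x2 x2 = q, dot x3 x3 = q & dot x4 x4 = q].
  by move: ss0; rewrite sE => ss0; split; lra.
have [d12' d13' d14'] : [/\ dot x1 x2 = 0, dot x1 x3 = 0 & dot x1 x4 = 0].
  by move: ss0; rewrite sE => ss0; split; lra.
have no_pair a b c : x1 + a + b + c = 2 *: theta -> c \in Gamma -> x1 != c ->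
    ~ (nat_comb Pi0 (theta - x1 - a) /\ nat_comb Pi0 (theta - x1 - b)) /\
    ~ (nat_comb Pi0 (- (theta - x1 - a)) /\ nat_comb Pi0 (- (theta - x1 - b))).
  move=> abc gc n1c; have incomp := antichain_incomp _ _ g1 gc n1c.
  have := pair_sum _ _ _ _ _ abc; rewrite -[LHS]opprK opprD => pairE.
  split=> -[/nat_combD ab /ab {}ab]; apply: incomp; [right|left].
    by rewrite -pairE opprD !opprK.
  by rewrite -opprB -pairE opprK.
have [no23p no23n] := no_pair _ _ _ sum_x g4 n14.
have [no24p no24n] := no_pair _ _ _ (etrans (addrAC _ _ _) sum_x) g3 n13.
have sum_x' : x1 + x3 + x4 + x2 = 2 *: theta.
  by rewrite -sum_x [RHS](ACl (1 * 3 * 4 * 2)).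
have [no34p no34n] := no_pair _ _ _ sum_x' g2 n12.
(* Pigeonhole: three vectors, two possible signs, and each of the three pairs is barred from sharing
   a sign. *)
have := diff_level0 x2 l2 d12' q2'; have := diff_level0 x3 l3 d13' q3'.
have := diff_level0 x4 l4 d14' q4'; tauto.
Qed.

Lemma card_antichain : (#|` Gamma| <= 3)%N.
Proof.
rewrite leqNgt; apply/negP; have := fset_uniq Gamma.
have : {subset enum_fset Gamma <= Gamma} by [].
case: (enum_fset Gamma) => [|x1 [|x2 [|x3 [|x4 s]]]] // sub uniqG _.
apply: (@antichain_four x1 x2 x3 x4).
  by move: uniqG; rewrite -[_ :: _]/([:: x1; x2; x3; x4] ++ s) cat_uniq => /andP[].
by move=> x xs; apply: sub; rewrite -[_ :: _]/([:: x1; x2; x3; x4] ++ s) mem_cat xs.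
Qed.

End Antichain.

End Highest.
End RootSystem.

Theorem theorem4p8 (R : realType) (g : vectType R[i])
    (br : {bilinear g -> g -> g}) (h : {vspace g})
    (V : vectType R) (dot : {dot V for idfun})
    (Delta Pi : {fset V}) (theta : V)
    (hg : simple_lie_algebra br)
    (hh : cartan_subalgebra br h)
    (hDelta : root_system_of br h dot Delta)
    (hPi : simple_roots Delta Pi)
    (htheta : highest_root Delta Pi theta) :
  let Delta1 := level dot theta Delta 1 in
  let Pi0 := level dot theta Pi 0 in
  (forall Gamma : {fset V}, antichain Pi0 Delta1 Gamma -> (#|` Gamma| <= 3)%N)
  /\ ((size (narayana_poly Pi0 Delta1)).-1 <= 3)%N.
Proof.
move=> Delta1 Pi0; case: hDelta => Delta_root _.
have card_le3 Gamma : antichain Pi0 Delta1 Gamma -> (#|` Gamma| <= 3)%N.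
  exact: (card_antichain dot _ _ _ Delta_root hPi htheta).
(* For a nonzero polynomial the size is the degree plus one, so the bound to prove is 4; a monomial
   of exponent at most 3 has size at most 4. *)
split=> //; suff : (size (narayana_poly Pi0 Delta1) <= 4)%N by case: size.
apply: (leq_trans (size_sum _ _ _)); apply/bigmax_leqP_seq => Gamma _.
by rewrite size_polyXn => /asboolP/card_le3.
Qed.
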